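(* Let $\lambda_0,\dots,\lambda_n$ be complex numbers such that $\lambda_0\notin\mathbb{R}$ and $\lambda_1=\overline{\lambda_0}$. Assume that $E_{(\lambda_0,\dots,\lambda_n)}$, $E_{(\lambda_2,\dots,\lambda_n)}$ and $E_{(\lambda_0,\lambda_1)}$ are extended Chebyshev spaces over $[a,b]$ ($a<b$), each closed under complex conjugation. Let $p_{n,0},\dots,p_{n,n}$ be a Bernstein basis of $E_{(\lambda_0,\dots,\lambda_n)}$ for $\{a,b\}$ consisting of real-valued functions non-negative on $[a,b]$. Then there exist unique points $t_0,\dots,t_n\in[a,b]$ and unique positive coefficients $\alpha_0,\dots,\alpha_n$ such that the operator $B_n:C[a,b]\to E_{(\lambda_0,\dots,\lambda_n)}$, $B_nf=\sum_{k=0}^nf(t_k)\alpha_kp_{n,k}$, satisfies $B_n(e^{\lambda_0x})=e^{\lambda_0x}$ and $B_n(e^{\lambda_1x})=e^{\lambda_1x}$.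
   Context: For complex numbers $\mu_0,\dots,\mu_m$, $E_{(\mu_0,\dots,\mu_m)}=\{f\in C^\infty(\mathbb{R},\mathbb{C}):(\frac{d}{dx}-\mu_0)\cdots(\frac{d}{dx}-\mu_m)f=0\}$ (dimension $m+1$), considered on $[a,b]$; it is closed under complex conjugation if $\bar f$ belongs to it whenever $f$ does. An $(m+1)$-dimensional space $V\subset C^m([a,b],\mathbb{C})$ is an extended Chebyshev space over $[a,b]$ if every non-zero $f\in V$ has at most $m$ zeros in $[a,b]$ counting multiplicities. A function has a zero of order $k$ at $c$ if $f(c)=\dots=f^{(k-1)}(c)=0\ne f^{(k)}(c)$ (one-sided at endpoints); a Bernstein basis for $\{a,b\}$ of an $(m+1)$-dimensional space is a system $p_{m,0},\dots,p_{m,m}$ in it with $p_{m,k}$ having a zero of order exactly $k$ at $a$ and exactly $m-k$ at $b$. The operator $B_n$ is applied to complex-valued continuous functions by the same formula. *)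

(* Defs.v *)
From Stdlib Require Import Reals List Arith Lia.
From Coquelicot Require Import Coquelicot.
Import ListNotations.
Open Scope R_scope.

Definition Dnc (f : R -> C) (j : nat) (x : R) : C :=
  (Derive_n (fun y => Re (f y)) j x, Derive_n (fun y => Im (f y)) j x).

Definition Dc (f : R -> C) (x : R) : C := Dnc f 1 x.

Definition smoothC (f : R -> C) : Prop :=
  forall (j : nat) (x : R),
    ex_derive_n (fun y => Re (f y)) j x /\ ex_derive_n (fun y => Im (f y)) j x.

Definition diff_op (mus : list C) (f : R -> C) : R -> C :=
  fold_right (fun mu g => fun x => Cminus (Dc g x) (Cmult mu (g x))) f mus.

Definition inE (mus : list C) (f : R -> C) : Prop :=
  smoothC f /\ forall x, diff_op mus f x = RtoC 0.

Definition zero_order_ge (f : R -> C) (c : R) (k : nat) : Prop :=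
  forall j, (j < k)%nat -> Dnc f j c = RtoC 0.

Definition zero_order (f : R -> C) (c : R) (k : nat) : Prop :=
  zero_order_ge f c k /\ Dnc f k c <> RtoC 0.

(* f has at most m zeros in [a,b] counting multiplicities: for any finite
   family of distinct points of [a,b] with prescribed lower bounds on the
   orders of the zeros there, the sum of these orders is at most m *)
Definition at_most_zeros (f : R -> C) (m : nat) (a b : R) : Prop :=
  forall zs : list (R * nat),
    NoDup (map fst zs) ->
    (forall z, In z zs -> a <= fst z <= b /\ zero_order_ge f (fst z) (snd z)) ->
    (fold_right Nat.add 0%nat (map snd zs) <= m)%nat.

(* E_(mus), of dimension m+1 = length mus, is an extended Chebyshev space over [a,b] *)
Definition ECT (mus : list C) (a b : R) : Prop :=
  forall f, inE mus f ->
    (exists x, a <= x <= b /\ f x <> RtoC 0) ->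
    at_most_zeros f (length mus - 1) a b.

Definition conj_closed (mus : list C) : Prop :=
  forall f, inE mus f -> inE mus (fun x => Cconj (f x)).

Definition cexp (lam : C) (x : R) : C :=
  (exp (Re lam * x) * cos (Im lam * x), exp (Re lam * x) * sin (Im lam * x)).

Fixpoint csum (g : nat -> C) (N : nat) : C :=
  match N with
  | O => RtoC 0
  | S N' => Cplus (csum g N') (g N')
  end.

Definition Bop (n : nat) (t alpha : nat -> R) (p : nat -> R -> C)
  (f : R -> C) (x : R) : C :=
  csum (fun k => Cmult (Cmult (f (t k)) (RtoC (alpha k))) (p k x)) (S n).

Definition lams (lam : nat -> C) (i len : nat) : list C := map lam (seq i len).

Definition bernstein_basis (mus : list C) (n : nat) (p : nat -> R -> C) (a b : R) : Prop :=
  forall k, (k <= n)%nat ->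
    inE mus (p k) /\ zero_order (p k) a k /\ zero_order (p k) b (n - k).

Definition good_nodes (lam : nat -> C) (n : nat) (p : nat -> R -> C) (a b : R)
  (t alpha : nat -> R) : Prop :=
  (forall k, (k <= n)%nat -> a <= t k <= b /\ 0 < alpha k) /\
  (forall x, a <= x <= b ->
     Bop n t alpha p (cexp (lam 0%nat)) x = cexp (lam 0%nat) x /\
     Bop n t alpha p (cexp (lam 1%nat)) x = cexp (lam 1%nat) x).

(* Main.v *)
Require Import Defs.
From Stdlib Require Import Reals List Arith Lia Lra.
From Stdlib Require Import FunctionalExtensionality ClassicalEpsilon.
From Coquelicot Require Import Coquelicot.
Open Scope R_scope.

(** Write [lam 0 = r + i v], [w = |v|] and [L = (D - lam 0)(D - lam 1)], a real operator;
    the extended Chebyshev property of [E_(lam 0, lam 1)] means [w (b - a) < pi].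
    The kernel of [L] is spanned by [phi = e^(r x) sin (w (x - a))] and
    [psi = e^(r x) sin (w (b - x))], so it suffices that their Bernstein coefficients
    [c k], [d k] are non-negative and not both zero: then [t k] and [alpha k] are the
    unique solution of [alpha phi(t) = c k], [alpha psi(t) = d k].  Positivity
    propagates from [c k] to [c (k+1)] by a Wronskian comparison, where the sign of [L]
    applied to a partial Bernstein sum is found by counting zeros in
    [E_(lam 2, ..., lam n)]. *)

(** The quotient [phi / psi] increases strictly from 0 at [a] to infinity at [b], so every ray of
    the closed first quadrant is hit by [(phi t, psi t)] for exactly one [t]; this is why the sign
    conditions on the pair [(c k, d k)] give one node and one weight. The obstacle is that the two
    first-order factors of [L] are not real, so no sign can be carried through them one at a time. A
    real solution positive on [[a,b)], namely [psi], handles both factors at once through the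
    Wronskian. The zero count is tight. For [k >= 1], [L] of the partial sum up to [k] vanishes to
    order [n-k-2] at [b] and at least [k-1] at [a], one less in total than the [n-2] zeros allowed.
    The assumption [c (k+1) <= 0] closes the gap: it makes this function either positive just after
    [a] or zero there to one order more, and in both cases a negative value would produce [n-1]
    zeros. *)

Definition smooth (f : R -> R) : Prop := forall j x, ex_derive_n f j x.

Fixpoint rsum (g : nat -> R) (N : nat) : R :=
  match N with
  | O => 0
  | S N' => rsum g N' + g N'
  end.

Definition lincomb (c : nat -> R) (q : nat -> R -> R) (N : nat) (x : R) : R :=
  rsum (fun k => c k * q k x) N.

(** For [P = -2r] and [K = r^2 + w^2], the values substituted later, the characteristic roots are
    [r + i w] and [r - i w]. *)
Definition Lop (P K : R) (f : R -> R) (x : R) : R :=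
  Derive_n f 2 x + P * Derive_n f 1 x + K * f x.

(** The real solutions for these roots. Differentiation acts linearly on the pair [(A, B)], which
    yields smoothness by induction. *)
Definition osc (r w A B x : R) : R := exp (r * x) * (A * cos (w * x) + B * sin (w * x)).

(* Sign normalisation: [q k] is positive on [(a,b)] close to [a] and close to [b]. *)
Definition real_bernstein (n : nat) (q : nat -> R -> R) (a b : R) : Prop :=
  forall k, (k <= n)%nat ->
    smooth (q k) /\
    (forall j, (j < k)%nat -> Derive_n (q k) j a = 0) /\
    0 < Derive_n (q k) k a /\
    (forall j, (j < n - k)%nat -> Derive_n (q k) j b = 0) /\
    0 < (-1) ^ (n - k) * Derive_n (q k) (n - k) b.

(** * Smooth real functions *)

Lemma Derive_n_Derive_S (f : R -> R) (j : nat) (x : R) :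
  Derive_n (Derive f) j x = Derive_n f (S j) x.
Proof.
  change (Derive f) with (Derive_n f 1). rewrite Derive_n_comp. f_equal. lia.
Qed.

Lemma smooth_Derive (f : R -> R) : smooth f -> smooth (Derive f).
Proof.
  intros H j x. destruct j as [|j]; [exact I|].
  apply ex_derive_ext with (Derive_n f (S j)).
  - intros t. symmetry. apply Derive_n_Derive_S.
  - exact (H (S (S j)) x).
Qed.

Lemma smooth_is_derive (f : R -> R) (j : nat) (x : R) :
  smooth f -> is_derive (Derive_n f j) x (Derive_n f (S j) x).
Proof. intros H. apply Derive_correct. exact (H (S j) x). Qed.

Lemma smooth_continuous (f : R -> R) : smooth f -> continuity f.
Proof.
  intros H x. apply continuity_pt_filterlim.
  apply (ex_derive_continuous (V := R_NormedModule)). exact (H 1%nat x).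
Qed.

Lemma smooth_plus (f g : R -> R) : smooth f -> smooth g -> smooth (fun x => f x + g x).
Proof.
  intros Hf Hg j x. apply ex_derive_n_plus; exists (mkposreal 1 Rlt_0_1); intros; auto.
Qed.

Lemma smooth_scal (c : R) (f : R -> R) : smooth f -> smooth (fun x => c * f x).
Proof. intros Hf j x. apply ex_derive_n_scal_l, Hf. Qed.

Lemma smooth_minus (f g : R -> R) : smooth f -> smooth g -> smooth (fun x => f x - g x).
Proof.
  intros Hf Hg j x. apply ex_derive_n_minus; exists (mkposreal 1 Rlt_0_1); intros; auto.
Qed.

Lemma smooth_const (c : R) : smooth (fun _ => c).
Proof. intros j x. apply ex_derive_n_const. Qed.

Lemma Derive_n_smooth_plus (f g : R -> R) (j : nat) (x : R) : smooth f -> smooth g ->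
  Derive_n (fun y => f y + g y) j x = Derive_n f j x + Derive_n g j x.
Proof.
  intros Hf Hg. apply Derive_n_plus; exists (mkposreal 1 Rlt_0_1); intros; auto.
Qed.

Lemma Derive_n_smooth_minus (f g : R -> R) (j : nat) (x : R) : smooth f -> smooth g ->
  Derive_n (fun y => f y - g y) j x = Derive_n f j x - Derive_n g j x.
Proof.
  intros Hf Hg. apply Derive_n_minus; exists (mkposreal 1 Rlt_0_1); intros; auto.
Qed.

Lemma Derive_n_zero (j : nat) (x : R) : Derive_n (fun _ => 0) j x = 0.
Proof. destruct j as [|j]; [reflexivity | apply Derive_n_const]. Qed.

(** Induction on the order: the derivative has a zero of order one less, hence is positive just
    after [a], and the mean value theorem transfers this to [f]. *)
Lemma pos_right_of_zero (k : nat) : forall (f : R -> R) (a : R), smooth f ->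
  (forall j, (j < k)%nat -> Derive_n f j a = 0) -> 0 < Derive_n f k a ->
  exists d, 0 < d /\ forall x, a < x < a + d -> 0 < f x.
Proof.
  induction k as [|k IH]; intros f a Hf H0 Hk.
  - destruct (smooth_continuous f Hf a (f a) Hk) as [d [Hd H]].
    exists d. split; [exact Hd|]. intros x Hx.
    assert (Hc : Rabs (f x - f a) < f a).
    { apply H. split; [split; [exact I | lra]|].
      simpl. unfold Rdist. rewrite Rabs_pos_eq; lra. }
    apply Rabs_def2 in Hc. lra.
  - destruct (IH (Derive f) a (smooth_Derive f Hf)) as [d [Hd H]].
    + intros j Hj. rewrite Derive_n_Derive_S. apply H0. lia.
    + now rewrite Derive_n_Derive_S.
    + exists d. split; [exact Hd|]. intros x Hx.
      destruct (MVT_cor2 f (Derive f) a x) as [c [E Hc]]; [lra | |].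
      * intros c _. apply is_derive_Reals, (smooth_is_derive f 0 c Hf).
      * assert (E0 := H0 0%nat ltac:(lia)). simpl in E0.
        assert (0 < Derive f c) by (apply H; lra). nra.
Qed.

(** The reflection of [pos_right_of_zero]; the factor [(-1)^k] is what replacing [x] by [-x] does to
    the derivative of order [k]. *)
Lemma pos_left_of_zero (k : nat) : forall (f : R -> R) (b : R), smooth f ->
  (forall j, (j < k)%nat -> Derive_n f j b = 0) -> 0 < (-1) ^ k * Derive_n f k b ->
  exists d, 0 < d /\ forall x, b - d < x < b -> 0 < f x.
Proof.
  intros f b Hf H0 Hk.
  assert (Hg : smooth (fun x => f (- x))).
  { intros j x. apply ex_derive_n_comp_opp.
    exists (mkposreal 1 Rlt_0_1); intros; apply Hf. }
  assert (Hd : forall j, Derive_n (fun x => f (- x)) j (- b) = (-1) ^ j * Derive_n f j b).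
  { intros j. rewrite Derive_n_comp_opp; [now rewrite Ropp_involutive|].
    exists (mkposreal 1 Rlt_0_1); intros; apply Hf. }
  destruct (pos_right_of_zero k _ (- b) Hg) as [d [Hdp H]].
  - intros j Hj. rewrite Hd, H0 by exact Hj. ring.
  - now rewrite Hd.
  - exists d. split; [exact Hdp|]. intros x Hx.
    rewrite <- (Ropp_involutive x). apply H. lra.
Qed.

Lemma exists_right_near (a b d : R) : a < b -> 0 < d ->
  exists x, a < x < b /\ x < a + d.
Proof.
  intros Hab Hd. exists (Rmin ((a + b) / 2) (a + d / 2)).
  assert (H1 := Rmin_l ((a + b) / 2) (a + d / 2)).
  assert (H2 := Rmin_r ((a + b) / 2) (a + d / 2)).
  assert (a < Rmin ((a + b) / 2) (a + d / 2)) by (apply Rmin_glb_lt; lra). lra.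
Qed.

Lemma exists_left_near (a b d : R) : a < b -> 0 < d ->
  exists x, a < x < b /\ b - d < x.
Proof.
  intros Hab Hd. exists (Rmax ((a + b) / 2) (b - d / 2)).
  assert (H1 := Rmax_l ((a + b) / 2) (b - d / 2)).
  assert (H2 := Rmax_r ((a + b) / 2) (b - d / 2)).
  assert (Rmax ((a + b) / 2) (b - d / 2) < b) by (apply Rmax_lub_lt; lra). lra.
Qed.

(** * Finite linear combinations *)

Lemma rsum_ext (g h : nat -> R) (N : nat) :
  (forall k, (k < N)%nat -> g k = h k) -> rsum g N = rsum h N.
Proof.
  induction N as [|N IH]; intros H; [reflexivity|].
  simpl. rewrite IH, H; auto.
Qed.

Lemma rsum_zero (g : nat -> R) (N : nat) :
  (forall k, (k < N)%nat -> g k = 0) -> rsum g N = 0.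
Proof.
  induction N as [|N IH]; intros H; [reflexivity|].
  simpl. rewrite IH, H by auto. ring.
Qed.

Lemma rsum_truncate (g : nat -> R) (m N : nat) : (m <= N)%nat ->
  (forall k, (m <= k < N)%nat -> g k = 0) -> rsum g N = rsum g m.
Proof.
  induction N as [|N IH]; intros Hm H.
  - replace m with 0%nat by lia. reflexivity.
  - destruct (Nat.eq_dec m (S N)) as [->|Hne]; [reflexivity|].
    simpl. rewrite IH, H by (intros; try apply H; lia). ring.
Qed.

Lemma rsum_linear (u v : R) (g h : nat -> R) (N : nat) :
  rsum (fun k => u * g k + v * h k) N = u * rsum g N + v * rsum h N.
Proof. induction N as [|N IH]; simpl; [ring|]. rewrite IH. ring. Qed.

Lemma smooth_lincomb (c : nat -> R) (q : nat -> R -> R) (N : nat) :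
  (forall k, (k < N)%nat -> smooth (q k)) -> smooth (lincomb c q N).
Proof.
  induction N as [|N IH]; intros H.
  - exact (smooth_const 0).
  - apply (smooth_plus (lincomb c q N) (fun x => c N * q N x)); [apply IH; auto|].
    apply smooth_scal; auto.
Qed.

Lemma Derive_n_lincomb (c : nat -> R) (q : nat -> R -> R) (N j : nat) (x : R) :
  (forall k, (k < N)%nat -> smooth (q k)) ->
  Derive_n (lincomb c q N) j x = rsum (fun k => c k * Derive_n (q k) j x) N.
Proof.
  induction N as [|N IH]; intros H.
  - exact (Derive_n_zero j x).
  - change (lincomb c q (S N)) with (fun x => lincomb c q N x + c N * q N x).
    rewrite Derive_n_smooth_plus.
    + simpl. rewrite IH by auto. now rewrite Derive_n_scal_l.
    + apply smooth_lincomb; auto.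
    + apply smooth_scal; auto.
Qed.

(** * The second-order operator *)

Lemma smooth_Lop (P K : R) (f : R -> R) : smooth f -> smooth (Lop P K f).
Proof.
  intros Hf. unfold Lop.
  apply (smooth_plus (fun x => Derive_n f 2 x + P * Derive_n f 1 x)).
  - apply (smooth_plus (fun x => Derive_n f 2 x)).
    + simpl. apply (smooth_Derive (Derive f)), smooth_Derive, Hf.
    + apply smooth_scal. apply (smooth_Derive f), Hf.
  - now apply smooth_scal.
Qed.

Lemma Derive_n_Lop (P K : R) (f : R -> R) (j : nat) (x : R) : smooth f ->
  Derive_n (Lop P K f) j x =
  Derive_n f (S (S j)) x + P * Derive_n f (S j) x + K * Derive_n f j x.
Proof.
  intros Hf. unfold Lop.
  assert (H1 : smooth (Derive_n f 1)) by (apply (smooth_Derive f), Hf).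
  assert (H2 : smooth (Derive_n f 2)) by (apply (smooth_Derive (Derive f)), H1).
  rewrite (Derive_n_smooth_plus (fun x => Derive_n f 2 x + P * Derive_n f 1 x)).
  - rewrite (Derive_n_smooth_plus (fun x => Derive_n f 2 x)); auto using smooth_scal.
    rewrite !Derive_n_scal_l.
    rewrite !Derive_n_comp. now rewrite (Nat.add_comm j 2), (Nat.add_comm j 1).
  - auto using smooth_plus, smooth_scal.
  - auto using smooth_scal.
Qed.

Lemma Lop_minus (P K : R) (f g : R -> R) (x : R) : smooth f -> smooth g ->
  Lop P K (fun y => f y - g y) x = Lop P K f x - Lop P K g x.
Proof.
  intros Hf Hg. unfold Lop. rewrite !Derive_n_smooth_minus by assumption. ring.
Qed.

(* [exp (P x) (h' s - h s')] has derivative [exp (P x) (L h) s]. *)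
Lemma comparison_right_end (P K : R) (h s : R -> R) (a b d : R) :
  a < b -> smooth h -> smooth s ->
  (forall x, Lop P K s x = 0) -> 0 <= s a -> (forall x, a < x < b -> 0 < s x) ->
  s b = 0 -> Derive s b < 0 -> h a = 0 -> 0 <= Derive h a ->
  (forall x, a < x < b -> 0 <= Lop P K h x) ->
  0 < d -> (forall x, b - d < x < b -> 0 < Lop P K h x) ->
  0 < h b.
Proof.
  intros Hab Hh Hs HL Hsa Hsp Hsb Hs'b Hha Hh'a HLh Hd HLd.
  set (V := fun x => exp (P * x) * (Derive h x * s x - h x * Derive s x)).
  assert (HV : forall x, derivable_pt_lim V x (exp (P * x) * (Lop P K h x * s x))).
  { intros x. apply is_derive_Reals. unfold V.
    assert (D1 : is_derive h x (Derive h x)) by exact (smooth_is_derive h 0 x Hh).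
    assert (D2 : is_derive (Derive h) x (Derive_n h 2 x)) by exact (smooth_is_derive h 1 x Hh).
    assert (D3 : is_derive s x (Derive s x)) by exact (smooth_is_derive s 0 x Hs).
    assert (D4 : is_derive (Derive s) x (Derive_n s 2 x)) by exact (smooth_is_derive s 1 x Hs).
    assert (E := HL x). unfold Lop in *.
    change (Derive_n s 1 x) with (Derive s x) in E.
    change (Derive_n h 1 x) with (Derive h x).
    evar_last.
    - apply (is_derive_mult (fun x => exp (P * x))
        (fun x => Derive h x * s x - h x * Derive s x)).
      + auto_derive; [exact I | reflexivity].
      + apply (is_derive_minus (V := R_NormedModule)
          (fun x => Derive h x * s x) (fun x => h x * Derive s x)).
        * apply (is_derive_mult (Derive h) s); eauto. intros; apply Rmult_comm.
        * apply (is_derive_mult h (Derive s)); eauto. intros; apply Rmult_comm.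
      + intros; apply Rmult_comm.
    - unfold minus, plus, mult, opp; cbn -[Derive_n].
      replace (Derive_n s 2 x) with (- P * Derive s x - K * s x) by lra. ring. }
  (* Strict positivity of [L h] is known only near [b], so the interval is split: [V] does not
     decrease from [a] to [m] and strictly increases from [m] to [b]. *)
  destruct (exists_left_near a b d) as (m & Hm); [lra | lra |].
  destruct (MVT_cor2 V (fun x => exp (P * x) * (Lop P K h x * s x)) a m)
    as [c1 [E1 Hc1]]; [lra | intros; apply HV |].
  destruct (MVT_cor2 V (fun x => exp (P * x) * (Lop P K h x * s x)) m b)
    as [c2 [E2 Hc2]]; [lra | intros; apply HV |].
  assert (0 <= exp (P * c1) * (Lop P K h c1 * s c1)).
  { apply Rmult_le_pos; [left; apply exp_pos|].
    apply Rmult_le_pos; [apply HLh | left; apply Hsp]; lra. }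
  assert (0 < exp (P * c2) * (Lop P K h c2 * s c2)).
  { apply Rmult_lt_0_compat; [apply exp_pos|].
    apply Rmult_lt_0_compat; [apply HLd | apply Hsp]; lra. }
  assert (Va : 0 <= V a).
  { unfold V. rewrite Hha. apply Rmult_le_pos; [left; apply exp_pos|].
    assert (0 <= Derive h a * s a) by (now apply Rmult_le_pos). lra. }
  assert (0 <= V m - V a) by (rewrite E1; apply Rmult_le_pos; lra).
  assert (Vb : 0 < V b - V m) by (rewrite E2; apply Rmult_lt_0_compat; lra).
  assert (Vb' : 0 < V b) by lra.
  (* Since [s b = 0], only [- exp (P b) h(b) s'(b)] remains of [V b]; as [s'(b) < 0], its positivity
     forces [h b > 0]. *)
  unfold V in Vb'. rewrite Hsb in Vb'.
  assert (He := exp_pos (P * b)).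
  destruct (Rlt_or_le 0 (h b)) as [|Hn]; [assumption | exfalso].
  assert (0 <= h b * Derive s b) by nra. nra.
Qed.

(** * Bernstein coefficients of solutions *)

Lemma at_most_zeros_RtoC (g : R -> R) (m : nat) (a b : R) (zs : list (R * nat)) :
  at_most_zeros (fun x => RtoC (g x)) m a b ->
  NoDup (map fst zs) ->
  (forall z, In z zs -> a <= fst z <= b /\
     forall j, (j < snd z)%nat -> Derive_n g j (fst z) = 0) ->
  (fold_right Nat.add 0%nat (map snd zs) <= m)%nat.
Proof.
  intros H Hnd Hz. apply H; [exact Hnd|].
  intros z Hin. destruct (Hz z Hin) as [H1 H2]. split; [exact H1|].
  intros j Hj. change ((Derive_n g j (fst z), Derive_n (fun _ => 0) j (fst z)) = RtoC 0).
  rewrite Derive_n_zero, (H2 j Hj). reflexivity.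
Qed.

Lemma zero_between (g : R -> R) (x y : R) : continuity g -> x < y ->
  g x * g y < 0 -> exists z, x < z < y /\ g z = 0.
Proof.
  intros Hg Hxy Hs.
  destruct (IVT_cor g x y Hg) as [z [Hz Ez]]; [lra | lra |].
  exists z. split; [|exact Ez].
  assert (z <> x) by (intros ->; nra). assert (z <> y) by (intros ->; nra). lra.
Qed.

(** A negative value at [x] gives a zero between [x] and [b], because [g] is positive just before
    [b]. At [a] either the order is at least [k], or the derivative of order [k-1] is positive and a
    further zero lies between [a] and [x]. Both cases total [k + m + 1] zeros. *)
Lemma nonneg_of_zero_count (g : R -> R) (a b : R) (k m : nat) :
  a < b -> smooth g ->
  at_most_zeros (fun x => RtoC (g x)) (k + m) a b ->
  (forall j, (S j < k)%nat -> Derive_n g j a = 0) ->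
  ((1 <= k)%nat -> 0 <= Derive_n g (k - 1) a) ->
  (forall j, (j < m)%nat -> Derive_n g j b = 0) ->
  0 < (-1) ^ m * Derive_n g m b ->
  forall x, a < x < b -> 0 <= g x.
Proof.
  intros Hab Hg Hz Ha Hka Hb Hmb x Hx.
  destruct (Rle_or_lt 0 (g x)) as [|Hneg]; [assumption | exfalso].
  destruct (pos_left_of_zero m g b Hg Hb Hmb) as [d [Hd Hpos]].
  destruct (exists_left_near x b d) as (x1 & Hx1); [lra | lra |].
  assert (0 < g x1) by (apply Hpos; lra).
  destruct (zero_between g x x1 (smooth_continuous g Hg)) as [y [Hy Ey]]; [lra | nra |].
  assert (Hcase : (forall j, (j < k)%nat -> Derive_n g j a = 0) \/
                  ((1 <= k)%nat /\ 0 < Derive_n g (k - 1) a)).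
  { destruct (Nat.eq_dec k 0) as [->|Hk]; [left; intros; lia|].
    destruct (Hka ltac:(lia)) as [Hlt|Heq]; [right; split; [lia | exact Hlt]|].
    left. intros j Hj. destruct (Nat.eq_dec j (k - 1)) as [->|]; [now symmetry|].
    apply Ha. lia. }
  destruct Hcase as [H0|[Hk Hlt]].
  - assert (Hle : (k + (m + (1 + 0)) <= k + m)%nat); [|lia].
    apply (at_most_zeros_RtoC g _ a b ((a, k) :: (b, m) :: (y, 1%nat) :: nil) Hz).
    + simpl. repeat constructor; simpl; intuition lra.
    + simpl. intros z [<-|[<-|[<-|[]]]]; simpl; (split; [lra|]); auto.
      intros j Hj. replace j with 0%nat by lia. exact Ey.
  - destruct (pos_right_of_zero (k - 1) g a Hg) as [e [He Hpe]].
    { intros j Hj. apply Ha. lia. } { exact Hlt. }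
    destruct (exists_right_near a x e) as (x0 & Hx0); [lra | lra |].
    assert (0 < g x0) by (apply Hpe; lra).
    destruct (zero_between g x0 x (smooth_continuous g Hg)) as [z [Hzz Ez]]; [lra | nra |].
    assert (Hle : (k - 1 + (m + (1 + (1 + 0))) <= k + m)%nat); [|lia].
    apply (at_most_zeros_RtoC g _ a b
      ((a, (k - 1)%nat) :: (b, m) :: (y, 1%nat) :: (z, 1%nat) :: nil) Hz).
    + simpl. repeat constructor; simpl; intuition lra.
    + simpl. intros u [<-|[<-|[<-|[<-|[]]]]]; simpl; (split; [lra|]); auto.
      * intros j Hj. apply Ha. lia.
      * intros j Hj. replace j with 0%nat by lia. exact Ey.
      * intros j Hj. replace j with 0%nat by lia. exact Ez.
Qed.

(* If [c (k+1) <= 0], the difference [h] of the partial sum up to [k] and [phi]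
   satisfies [L h >= 0] by zero counting, has [h a = 0 <= h' a], and so
   [h b > 0] by comparison; but [h b = - phi b]. *)
Lemma bernstein_coef_step (n : nat) (q : nat -> R -> R) (a b P K : R)
    (s phi : R -> R) (c : nat -> R) (k : nat) :
  a < b -> real_bernstein n q a b ->
  smooth s -> (forall x, Lop P K s x = 0) -> 0 <= s a ->
  (forall x, a < x < b -> 0 < s x) -> s b = 0 -> Derive s b < 0 ->
  (forall m, let g := Lop P K (lincomb c q (S m)) in (S (S m) <= n)%nat ->
     (exists x, a <= x <= b /\ g x <> 0) ->
     at_most_zeros (fun x => RtoC (g x)) (n - 2) a b) ->
  smooth phi -> (forall x, Lop P K phi x = 0) -> 0 <= phi b ->
  (forall j, (j <= n)%nat -> Derive_n phi j a = Derive_n (lincomb c q (S n)) j a) ->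
  (S (S k) <= n)%nat -> 0 < c k -> 0 < c (S k).
Proof.
  intros Hab Hq Hs HLs Hsa Hsp Hsb Hs'b HF Hphi HLphi Hphib Hexp Hk Hck.
  destruct (Rlt_or_le 0 (c (S k))) as [|Hneg]; [assumption | exfalso].
  assert (Hsm : forall i, (i < S n)%nat -> smooth (q i)) by (intros i Hi; apply (Hq i); lia).
  set (f := lincomb c q (S k)).
  assert (Hf : smooth f) by (apply smooth_lincomb; intros i Hi; apply Hsm; lia).
  set (h := fun x => f x - phi x).
  assert (Hh : smooth h) by (now apply smooth_minus).
  assert (HLh : forall x, Lop P K h x = Lop P K f x).
  { intros x. unfold h. rewrite Lop_minus, HLphi by assumption. ring. }
  assert (Efb : forall j, (j < n - k)%nat -> Derive_n f j b = 0).
  { intros j Hj. unfold f. rewrite Derive_n_lincomb by (intros i Hi; apply Hsm; lia).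
    apply rsum_zero. intros i Hi.
    destruct (Hq i ltac:(lia)) as (_ & _ & _ & H & _). rewrite H by lia. ring. }
  assert (Efbk : Derive_n f (n - k) b = c k * Derive_n (q k) (n - k) b).
  { unfold f. rewrite Derive_n_lincomb by (intros i Hi; apply Hsm; lia).
    simpl. rewrite rsum_zero; [ring|]. intros i Hi.
    destruct (Hq i ltac:(lia)) as (_ & _ & _ & H & _). rewrite H by lia. ring. }
  assert (Eha : forall j, (j <= k)%nat -> Derive_n h j a = 0).
  { intros j Hj. unfold h. rewrite Derive_n_smooth_minus, Hexp by (assumption || lia).
    unfold f. rewrite !Derive_n_lincomb by (intros i Hi; apply Hsm; lia).
    rewrite (rsum_truncate _ (S k) (S n)); [ring | lia |].
    intros i Hi. destruct (Hq i ltac:(lia)) as (_ & H & _). rewrite H by lia. ring. }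
  (* Order [k+1] is the first at which the truncation shows: the derivative is [- c (k+1)] times the
     positive leading derivative of [q (k+1)], and [Hneg] enters here. *)
  assert (Ehak : 0 <= Derive_n h (S k) a).
  { unfold h. rewrite Derive_n_smooth_minus, Hexp by (assumption || lia).
    unfold f. rewrite !Derive_n_lincomb by (intros i Hi; apply Hsm; lia).
    rewrite (rsum_truncate _ (S (S k)) (S n)); [| lia |].
    - destruct (Hq (S k) ltac:(lia)) as (_ & _ & H & _).
      simpl rsum. simpl in H |- *. nra.
    - intros i Hi. destruct (Hq i ltac:(lia)) as (_ & H & _). rewrite H by lia. ring. }
  set (g := Lop P K f).
  assert (Hg : smooth g) by (now apply smooth_Lop).
  set (m := (n - k - 2)%nat).
  assert (Em : (n - k)%nat = S (S m)) by (unfold m; lia).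
  assert (Hgb : forall j, (j < m)%nat -> Derive_n g j b = 0).
  { intros j Hj. unfold g. rewrite Derive_n_Lop by assumption.
    rewrite !Efb by lia. ring. }
  (* Of the three terms of [L f] only the second derivative survives at order [m], giving [c k]
     times the leading derivative of [q k] at [b]. The alternating sign is the same for [m] and for
     [n - k = m + 2]. *)
  assert (Hgbm : 0 < (-1) ^ m * Derive_n g m b).
  { unfold g. rewrite Derive_n_Lop by assumption.
    rewrite (Efb (S m)), (Efb m), <- Em, Efbk by lia.
    destruct (Hq k ltac:(lia)) as (_ & _ & _ & _ & H).
    rewrite Em in H at 1. simpl pow in H. nra. }
  destruct (pos_left_of_zero m g b Hg Hgb Hgbm) as [d [Hd Hpos]].
  (* The zeros at [b] are read off [f] and those at [a] off [h]; since [L phi = 0], both describe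
     the same [g]. *)
  assert (Hga : g = Lop P K h) by (apply functional_extensionality; intro; now rewrite HLh).
  assert (Hnn : forall x, a < x < b -> 0 <= g x).
  { apply (nonneg_of_zero_count g a b k m Hab Hg).
    - replace (k + m)%nat with (n - 2)%nat by (unfold m; lia).
      apply (HF k Hk).
      destruct (exists_left_near a b d) as (x1 & Hx1); [lra | lra |].
      exists x1. split; [lra|]. apply Rgt_not_eq, Hpos. lra.
    - intros j Hj. rewrite Hga, Derive_n_Lop by assumption.
      rewrite !Eha by lia. ring.
    - intros Hk1. rewrite Hga, Derive_n_Lop by assumption.
      rewrite (Eha (S (k - 1))), (Eha (k - 1)%nat) by lia.
      replace (S (S (k - 1))) with (S k) by lia. lra.
    - exact Hgb.
    - exact Hgbm. }
  assert (Hhb : 0 < h b).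
  { apply (comparison_right_end P K h s a b d); auto.
    - apply (Eha 0%nat). lia.
    (* For [k = 0] the slope of [h] at [a] is the derivative bounded in [Ehak]; for larger [k] it is
       zero. *)
    - destruct k as [|k']; [exact Ehak|]. right. symmetry. apply (Eha 1%nat). lia.
    - rewrite <- Hga. exact Hnn.
    - rewrite <- Hga. exact Hpos. }
  assert (E0 := Efb 0%nat ltac:(lia)). simpl in E0. unfold h in Hhb. lra.
Qed.

(** The matrix of derivatives of the [q k] at [a] is triangular with positive diagonal, so the
    coefficients come from forward substitution; [v] is the next one. *)
Lemma bernstein_taylor (n : nat) (q : nat -> R -> R) (a b : R) (f : R -> R) (m : nat) :
  real_bernstein n q a b -> smooth f -> (m <= S n)%nat ->
  exists c, forall j, (j < m)%nat -> Derive_n f j a = Derive_n (lincomb c q m) j a.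
Proof.
  intros Hq Hf. induction m as [|m IH]; intros Hm; [exists (fun _ => 0); intros; lia|].
  destruct (IH ltac:(lia)) as [c Hc].
  assert (Hsm : forall i, (i < S n)%nat -> smooth (q i)) by (intros i Hi; apply (Hq i); lia).
  destruct (Hq m ltac:(lia)) as (_ & H0 & Hp & _).
  set (v := (Derive_n f m a - Derive_n (lincomb c q m) m a) / Derive_n (q m) m a).
  exists (fun k => if Nat.eq_dec k m then v else c k). intros j Hj.
  rewrite Derive_n_lincomb by (intros i Hi; apply Hsm; lia).
  simpl. destruct (Nat.eq_dec m m) as [_|]; [|easy].
  rewrite (rsum_ext _ (fun k => c k * Derive_n (q k) j a)).
  2: { intros i Hi. destruct (Nat.eq_dec i m); [lia | reflexivity]. }
  rewrite <- Derive_n_lincomb by (intros i Hi; apply Hsm; lia).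
  destruct (Nat.eq_dec j m) as [->|].
  - unfold v. field. lra.
  - rewrite H0, <- Hc by lia. ring.
Qed.

(** The first non-zero coefficient would fix the sign of the sum just after [a]. A sign argument is
    used because the sum is known to vanish only on [[a,b]], while [Derive_n] at [a] is two-sided.
    The scalar [u] is taken as 1 and -1 to cover both signs. *)
Lemma bernstein_independent (n : nat) (q : nat -> R -> R) (a b : R) (d : nat -> R) :
  a < b -> real_bernstein n q a b ->
  (forall x, a <= x <= b -> lincomb d q (S n) x = 0) ->
  forall k, (k <= n)%nat -> d k = 0.
Proof.
  intros Hab Hq Hz k. induction k as [k IH] using (well_founded_induction lt_wf). intros Hk.
  assert (Hsm : forall i, (i < S n)%nat -> smooth (q i)) by (intros i Hi; apply (Hq i); lia).
  assert (HD : forall u j, (j <= k)%nat ->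
     Derive_n (lincomb (fun i => u * d i) q (S n)) j a = u * d k * Derive_n (q k) j a).
  { intros u j Hj. rewrite Derive_n_lincomb by exact Hsm.
    rewrite (rsum_truncate _ (S k)); [| lia |].
    - simpl. rewrite rsum_zero; [ring|]. intros i Hi. rewrite IH by lia. ring.
    - intros i Hi. destruct (Hq i ltac:(lia)) as (_ & H & _). rewrite H by lia. ring. }
  assert (Hcon : forall u, ~ 0 < u * d k).
  { intros u Hu. destruct (Hq k Hk) as (_ & H0 & Hp & _).
    destruct (pos_right_of_zero k (lincomb (fun i => u * d i) q (S n)) a) as [e [He H]].
    - now apply smooth_lincomb.
    - intros j Hj. rewrite HD, H0 by lia. ring.
    - rewrite HD by lia. now apply Rmult_lt_0_compat.
    - destruct (exists_right_near a b e) as (x & Hx); [lra | lra |].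
      assert (Hx0 := H x ltac:(lra)).
      assert (Hzx := Hz x ltac:(lra)). unfold lincomb in Hx0, Hzx.
      rewrite (rsum_ext _ (fun k => u * (d k * q k x) + 0 * 0)) in Hx0 by (intros; ring).
      rewrite rsum_linear, Hzx in Hx0. lra. }
  assert (H1 := Hcon 1). assert (H2 := Hcon (-1)). lra.
Qed.

(** * Solutions of the second-order equation *)

Lemma osc_is_derive (r w A B x : R) :
  is_derive (osc r w A B) x (osc r w (r * A + w * B) (r * B - w * A) x).
Proof. unfold osc. auto_derive; [exact I | ring]. Qed.

Lemma Derive_n_osc (r w : R) (j : nat) : forall A B,
  exists A' B', forall x, Derive_n (osc r w A B) j x = osc r w A' B' x.
Proof.
  induction j as [|j IH]; intros A B; [now exists A, B|].
  destruct (IH A B) as (A' & B' & E).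
  exists (r * A' + w * B'), (r * B' - w * A'). intros x. simpl.
  rewrite (Derive_ext _ (osc r w A' B') x E). apply is_derive_unique, osc_is_derive.
Qed.

Lemma smooth_osc (r w A B : R) : smooth (osc r w A B).
Proof.
  intros j x. destruct j as [|j]; [exact I|].
  destruct (Derive_n_osc r w j A B) as (A' & B' & E).
  apply ex_derive_ext with (osc r w A' B'); [intros t; now rewrite E|].
  eexists. apply osc_is_derive.
Qed.

Lemma Derive_osc (r w A B x : R) :
  Derive (osc r w A B) x = osc r w (r * A + w * B) (r * B - w * A) x.
Proof. apply is_derive_unique, osc_is_derive. Qed.

Lemma Lop_osc (r w A B x : R) : Lop (- (2 * r)) (r * r + w * w) (osc r w A B) x = 0.
Proof.
  unfold Lop.
  change (Derive_n (osc r w A B) 2 x) with (Derive (fun y => Derive (osc r w A B) y) x).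
  change (Derive_n (osc r w A B) 1 x) with (Derive (osc r w A B) x).
  rewrite (Derive_ext (fun y => Derive (osc r w A B) y)
    (osc r w (r * A + w * B) (r * B - w * A)) x (Derive_osc r w A B)).
  rewrite !Derive_osc. unfold osc. ring.
Qed.

Lemma osc_sin_minus_left (r w a x : R) :
  osc r w (- sin (w * a)) (cos (w * a)) x = exp (r * x) * sin (w * (x - a)).
Proof. unfold osc. rewrite Rmult_minus_distr_l, sin_minus. ring. Qed.

Lemma osc_sin_minus_right (r w b x : R) :
  osc r w (sin (w * b)) (- cos (w * b)) x = exp (r * x) * sin (w * (b - x)).
Proof. unfold osc. rewrite Rmult_minus_distr_l, sin_minus. ring. Qed.

(** * Positivity of the two families of coefficients *)

(** Both families are propagated with [psi] as comparison function. The step loses two orders at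
    [b], so it reaches only index [n-1], and the remaining indices come from endpoint data:
    [psi a > 0] gives [d 0 > 0] and [psi b = 0] gives [d n = 0]; [phi a = 0] gives [c 0 = 0],
    [phi' a > 0] gives [c 1 > 0], and [phi b > 0] gives [c n > 0]. *)
Lemma osc_coefs_positive (n : nat) (q : nat -> R -> R) (a b r w : R) (c d : nat -> R) :
  let L := Lop (- (2 * r)) (r * r + w * w) in
  let phi := osc r w (- sin (w * a)) (cos (w * a)) in
  let psi := osc r w (sin (w * b)) (- cos (w * b)) in
  (1 <= n)%nat -> a < b -> 0 < w -> w * (b - a) < PI -> real_bernstein n q a b ->
  (forall e m, let g := L (lincomb e q (S m)) in (S (S m) <= n)%nat ->
     (exists x, a <= x <= b /\ g x <> 0) ->
     at_most_zeros (fun x => RtoC (g x)) (n - 2) a b) ->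
  (forall j, (j <= n)%nat -> Derive_n phi j a = Derive_n (lincomb c q (S n)) j a) ->
  (forall j, (j <= n)%nat -> Derive_n psi j a = Derive_n (lincomb d q (S n)) j a) ->
  phi b = lincomb c q (S n) b -> psi b = lincomb d q (S n) b ->
  forall k, (k <= n)%nat -> 0 <= c k /\ 0 <= d k /\ 0 < c k + d k.
Proof.
  intros L phi psi Hn Hab Hw HPI Hq HF Hc Hd Hcb Hdb.
  assert (Hsm : forall i, (i < S n)%nat -> smooth (q i)) by (intros i Hi; apply (Hq i); lia).
  assert (Epsi : forall x, psi x = exp (r * x) * sin (w * (b - x)))
    by (intros; apply osc_sin_minus_right).
  assert (Ephi : forall x, phi x = exp (r * x) * sin (w * (x - a)))
    by (intros; apply osc_sin_minus_left).
  assert (Hpsip : forall x, a <= x < b -> 0 < psi x).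
  { intros x Hx. rewrite Epsi. apply Rmult_lt_0_compat; [apply exp_pos|].
    apply sin_gt_0; nra. }
  assert (Hpsib : psi b = 0).
  { rewrite Epsi, Rminus_diag, Rmult_0_r, sin_0. ring. }
  assert (Hpsi'b : Derive psi b < 0).
  { unfold psi. rewrite Derive_osc. unfold osc.
    assert (H := sin2_cos2 (w * b)). unfold Rsqr in H.
    replace (_ * _) with (- w * exp (r * b) *
      (sin (w * b) * sin (w * b) + cos (w * b) * cos (w * b))) by ring.
    rewrite H. assert (He := exp_pos (r * b)). nra. }
  assert (Hphib : 0 < phi b).
  { rewrite Ephi. apply Rmult_lt_0_compat; [apply exp_pos|]. apply sin_gt_0; nra. }
  assert (Hphia : phi a = 0).
  { rewrite Ephi, Rminus_diag, Rmult_0_r, sin_0. ring. }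
  assert (Hphi'a : 0 < Derive phi a).
  { unfold phi. rewrite Derive_osc. unfold osc.
    assert (H := sin2_cos2 (w * a)). unfold Rsqr in H.
    replace (_ * _) with (w * exp (r * a) *
      (sin (w * a) * sin (w * a) + cos (w * a) * cos (w * a))) by ring.
    rewrite H. assert (He := exp_pos (r * a)). nra. }
  assert (Hstep : forall A B e k, 0 <= osc r w A B b ->
    (forall j, (j <= n)%nat ->
       Derive_n (osc r w A B) j a = Derive_n (lincomb e q (S n)) j a) ->
    (S (S k) <= n)%nat -> 0 < e k -> 0 < e (S k)).
  { intros A B e k Hb He Hk Hek.
    apply (bernstein_coef_step n q a b (- (2 * r)) (r * r + w * w) psi (osc r w A B));
      auto using smooth_osc, Lop_osc.
    - apply smooth_osc.
    - intros; apply Lop_osc.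
    - left. apply Hpsip. lra.
    - intros x Hx. apply Hpsip. lra.
    - intros m g. apply HF. }
  assert (Hlb : forall e, lincomb e q (S n) b = e n * q n b).
  { intros e. unfold lincomb. simpl. rewrite rsum_zero; [ring|]. intros i Hi.
    destruct (Hq i ltac:(lia)) as (_ & _ & _ & H & _).
    specialize (H 0%nat ltac:(lia)). simpl in H. rewrite H. ring. }
  assert (Hla : forall e, lincomb e q (S n) a = e 0%nat * q 0%nat a).
  { intros e. unfold lincomb. rewrite (rsum_truncate _ 1); [simpl; ring | lia |].
    intros i Hi. destruct (Hq i ltac:(lia)) as (_ & H & _).
    specialize (H 0%nat ltac:(lia)). simpl in H. rewrite H. ring. }
  destruct (Hq n ltac:(lia)) as (_ & _ & _ & _ & Hqn).
  rewrite Nat.sub_diag in Hqn. simpl in Hqn. rewrite Rmult_1_l in Hqn.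
  destruct (Hq 0%nat ltac:(lia)) as (_ & _ & Hq0 & _). simpl in Hq0.
  assert (Hd0 : 0 < d 0%nat).
  { assert (E := Hd 0%nat ltac:(lia)). simpl in E. rewrite Hla in E.
    assert (H := Hpsip a ltac:(lra)). nra. }
  assert (Hdk : forall k, (k < n)%nat -> 0 < d k).
  { intros k. induction k as [|k IH]; intros Hk; [exact Hd0|].
    apply (Hstep (sin (w * b)) (- cos (w * b)) d k); auto; [|apply IH; lia].
    fold psi. lra. }
  assert (Hdn : d n = 0).
  { rewrite Hlb, Hpsib in Hdb. nra. }
  assert (Hc0 : c 0%nat = 0).
  { assert (E := Hc 0%nat ltac:(lia)). simpl in E. rewrite Hla, Hphia in E. nra. }
  assert (Hc1 : 0 < c 1%nat).
  { assert (E := Hc 1%nat ltac:(lia)). rewrite (Derive_n_lincomb c q) in E by exact Hsm.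
    rewrite (rsum_truncate _ 2) in E; [| lia |].
    - destruct (Hq 1%nat ltac:(lia)) as (_ & _ & Hq1 & _).
      simpl in E, Hq1. rewrite Hc0 in E.
      change (Derive (fun x => phi x) a) with (Derive phi a) in E. nra.
    - intros i Hi. destruct (Hq i ltac:(lia)) as (_ & H & _). rewrite H by lia. ring. }
  assert (Hck : forall k, (1 <= k <= n)%nat -> 0 < c k).
  { assert (Hlt : forall k, (S k < n)%nat -> 0 < c (S k)).
    { intros k. induction k as [|k IH]; intros Hk; [exact Hc1|].
      apply (Hstep (- sin (w * a)) (cos (w * a)) c (S k)); auto; [|apply IH; lia].
      fold phi. lra. }
    intros k Hk. destruct (Nat.eq_dec k n) as [->|].
    - rewrite Hlb in Hcb. nra.
    - destruct k as [|k]; [lia|]. apply Hlt. lia. }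
  intros k Hk. destruct (Nat.eq_dec k 0) as [->|Hk0]; [rewrite Hc0; lra|].
  assert (H := Hck k ltac:(lia)).
  destruct (Nat.eq_dec k n) as [->|Hkn]; [rewrite Hdn; lra|].
  assert (H' := Hdk k ltac:(lia)). lra.
Qed.

(** * Solving for a node and its weight *)

Lemma node_exists (a b r w c d : R) :
  a < b -> 0 < w -> w * (b - a) < PI -> 0 <= c -> 0 <= d -> 0 < c + d ->
  exists t alpha, a <= t <= b /\ 0 < alpha /\
    alpha * (exp (r * t) * sin (w * (t - a))) = c /\
    alpha * (exp (r * t) * sin (w * (b - t))) = d.
Proof.
  intros Hab Hw HPI Hc Hd Hcd.
  assert (Hs : 0 < sin (w * (b - a))) by (apply sin_gt_0; nra).
  (* Eliminating [alpha] and the exponential from the two equations leaves [F t = 0]. *)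
  set (F := fun t => c * sin (w * (b - t)) - d * sin (w * (t - a))).
  assert (HF : continuity F) by (unfold F; reg).
  assert (Fa : 0 <= F a).
  { unfold F. rewrite Rminus_diag, Rmult_0_r, sin_0. nra. }
  assert (Fb : F b <= 0).
  { unfold F. rewrite Rminus_diag, Rmult_0_r, sin_0. nra. }
  destruct (IVT_cor F a b HF) as [t [Ht Et]]; [lra | nra |].
  unfold F in Et.
  set (sa := sin (w * (t - a))) in *. set (sb := sin (w * (b - t))) in *.
  assert (Hsa : 0 <= sa) by (apply sin_ge_0; nra).
  assert (Hsb : 0 <= sb) by (apply sin_ge_0; nra).
  assert (Hss : 0 < sa + sb).
  { destruct (Rle_lt_or_eq_dec a t ltac:(lra)) as [Hlt|<-].
    - assert (0 < sa) by (apply sin_gt_0; nra). lra.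
    - change (sin (w * (b - a))) with sb in Hs. lra. }
  assert (He := exp_pos (r * t)).
  (* Adding the two equations determines the weight; the sum [sa + sb] is positive even when one of
     the sines vanishes. *)
  exists t, ((c + d) / (exp (r * t) * (sa + sb))).
  split; [exact Ht|]. split; [|split].
  - apply Rdiv_lt_0_compat; [exact Hcd | nra].
  - transitivity ((c + d) * sa / (sa + sb)); [fold sa; field; lra|].
    replace ((c + d) * sa) with (c * (sa + sb)) by nra. field. lra.
  - transitivity ((c + d) * sb / (sa + sb)); [fold sb; field; lra|].
    replace ((c + d) * sb) with (d * (sa + sb)) by nra. field. lra.
Qed.

(** Cross-multiplication removes the weights, and the difference of sine products factors as
    [sin (w (t' - t)) * sin (w (b - a))]. The first factor vanishes only for [t' = t], since
    [w |t' - t| < PI]. The weight then follows from whichever of the two equations has a non-zero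
    sine at [t]. *)
Lemma node_unique (a b r w t t' al al' : R) :
  a < b -> 0 < w -> w * (b - a) < PI ->
  a <= t <= b -> a <= t' <= b -> 0 < al -> 0 < al' ->
  al' * (exp (r * t') * sin (w * (t' - a))) = al * (exp (r * t) * sin (w * (t - a))) ->
  al' * (exp (r * t') * sin (w * (b - t'))) = al * (exp (r * t) * sin (w * (b - t))) ->
  t' = t /\ al' = al.
Proof.
  intros Hab Hw HPI Ht Ht' Hal Hal' Ea Eb.
  assert (He := exp_pos (r * t)). assert (He' := exp_pos (r * t')).
  assert (Hs : 0 < sin (w * (b - a))) by (apply sin_gt_0; nra).
  assert (Htt : t' = t).
  { assert (Ecross : al * exp (r * t) * (al' * exp (r * t')) *
        (sin (w * (t' - a)) * sin (w * (b - t)) -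
         sin (w * (b - t')) * sin (w * (t - a))) = 0).
    { replace (_ * _) with
        (al' * (exp (r * t') * sin (w * (t' - a))) * (al * (exp (r * t) * sin (w * (b - t))))
       - al' * (exp (r * t') * sin (w * (b - t'))) * (al * (exp (r * t) * sin (w * (t - a)))))
        by ring. rewrite Ea, Eb. ring. }
    assert (Etrig : sin (w * (t' - a)) * sin (w * (b - t)) -
         sin (w * (b - t')) * sin (w * (t - a)) = sin (w * (t' - t)) * sin (w * (b - a))).
    { rewrite !Rmult_minus_distr_l, !sin_minus. ring. }
    rewrite Etrig in Ecross.
    assert (E0 : sin (w * (t' - t)) = 0).
    { assert (0 < al * exp (r * t)) by nra. assert (0 < al' * exp (r * t')) by nra.
      apply Rmult_integral in Ecross as [E|E]; [nra|].
      apply Rmult_integral in E as [E|E]; [exact E | lra]. }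
    destruct (Rtotal_order t' t) as [Hlt|[E|Hgt]]; [exfalso | exact E | exfalso].
    - assert (0 < sin (w * (t - t'))) by (apply sin_gt_0; nra).
      replace (w * (t' - t)) with (- (w * (t - t'))) in E0 by ring.
      rewrite sin_neg in E0. lra.
    - assert (0 < sin (w * (t' - t))) by (apply sin_gt_0; nra). lra. }
  subst t'. split; [reflexivity|].
  destruct (Rle_lt_or_eq_dec a t ltac:(lra)) as [Hlt|<-].
  - assert (0 < sin (w * (t - a))) by (apply sin_gt_0; nra).
    apply (Rmult_eq_reg_r (exp (r * t) * sin (w * (t - a)))); [exact Ea | nra].
  - apply (Rmult_eq_reg_r (exp (r * a) * sin (w * (b - a)))); [exact Eb | nra].
Qed.

(** Interpolation from the endpoints: the brackets are the values at [b] and [a] without their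
    exponential factors. *)
Lemma osc_endpoint_decomposition (r w A B a b x : R) :
  sin (w * (b - a)) * osc r w A B x =
  (A * cos (w * b) + B * sin (w * b)) * (exp (r * x) * sin (w * (x - a))) +
  (A * cos (w * a) + B * sin (w * a)) * (exp (r * x) * sin (w * (b - x))).
Proof. unfold osc. rewrite !Rmult_minus_distr_l, !sin_minus. ring. Qed.

(** * The differential operators on complex-valued functions *)

(** One factor of [diff_op], convertible with the body of its [fold_right]. *)
Definition Dminus (mu : C) (f : R -> C) (x : R) : C := Cminus (Dc f x) (Cmult mu (f x)).

Lemma Re_Dminus (mu : C) (f : R -> C) :
  (fun x => Re (Dminus mu f x)) =
  (fun x => Derive (fun y => Re (f y)) x - (Re mu * Re (f x) - Im mu * Im (f x))).
Proof. apply functional_extensionality; intros x. reflexivity. Qed.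

Lemma Im_Dminus (mu : C) (f : R -> C) :
  (fun x => Im (Dminus mu f x)) =
  (fun x => Derive (fun y => Im (f y)) x - (Re mu * Im (f x) + Im mu * Re (f x))).
Proof. apply functional_extensionality; intros x. reflexivity. Qed.

Lemma smoothC_iff (f : R -> C) :
  smoothC f <-> smooth (fun x => Re (f x)) /\ smooth (fun x => Im (f x)).
Proof.
  split; [intros H; split; intros j x; apply (H j x) | intros [H1 H2] j x; auto].
Qed.

Lemma smoothC_RtoC (f : R -> R) : smoothC (fun x => RtoC (f x)) <-> smooth f.
Proof.
  rewrite smoothC_iff. split; [intros [H _]; exact H | intros H; split; [exact H|]].
  exact (smooth_const 0).
Qed.

Lemma Ceq (z1 z2 : C) : Re z1 = Re z2 -> Im z1 = Im z2 -> z1 = z2.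
Proof. apply injective_projections. Qed.

Lemma smoothC_Dminus (mu : C) (f : R -> C) : smoothC f -> smoothC (Dminus mu f).
Proof.
  rewrite !smoothC_iff, Re_Dminus, Im_Dminus. intros [H1 H2].
  split; apply smooth_minus; auto using smooth_minus, smooth_plus, smooth_scal, smooth_Derive.
Qed.

Lemma smoothC_diff_op (mus : list C) (f : R -> C) : smoothC f -> smoothC (diff_op mus f).
Proof.
  intros H. induction mus as [|mu mus IH]; [exact H|].
  exact (smoothC_Dminus mu _ IH).
Qed.

Lemma Derive_linear2 (u v : R) (f g h : R -> R) (x : R) :
  smooth f -> smooth g -> smooth h ->
  Derive (fun y => f y - (u * g y + v * h y)) x =
  Derive f x - (u * Derive g x + v * Derive h x).
Proof.
  intros Hf Hg Hh. apply is_derive_unique.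
  assert (D1 := smooth_is_derive f 0 x Hf). assert (D2 := smooth_is_derive g 0 x Hg).
  assert (D3 := smooth_is_derive h 0 x Hh). simpl in D1, D2, D3.
  apply (is_derive_minus (V := R_NormedModule) f (fun y => u * g y + v * h y));
    [exact D1|].
  apply (is_derive_plus (V := R_NormedModule) (fun y => u * g y) (fun y => v * h y)).
  - apply (is_derive_scal g x u _ D2).
  - apply (is_derive_scal h x v _ D3).
Qed.

Lemma Derive_Re_Dminus (mu : C) (f : R -> C) (x : R) : smoothC f ->
  Derive (fun y => Re (Dminus mu f y)) x =
  Derive (Derive (fun y => Re (f y))) x
  - (Re mu * Derive (fun y => Re (f y)) x + - Im mu * Derive (fun y => Im (f y)) x).
Proof.
  rewrite smoothC_iff. intros [H1 H2]. rewrite Re_Dminus.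
  rewrite <- (Derive_linear2 (Re mu) (- Im mu) (Derive (fun y => Re (f y)))
    (fun y => Re (f y)) (fun y => Im (f y))); auto using smooth_Derive.
  apply Derive_ext. intros; ring.
Qed.

Lemma Derive_Im_Dminus (mu : C) (f : R -> C) (x : R) : smoothC f ->
  Derive (fun y => Im (Dminus mu f y)) x =
  Derive (Derive (fun y => Im (f y))) x
  - (Re mu * Derive (fun y => Im (f y)) x + Im mu * Derive (fun y => Re (f y)) x).
Proof.
  rewrite smoothC_iff. intros [H1 H2]. rewrite Im_Dminus.
  apply Derive_linear2; auto using smooth_Derive.
Qed.

Lemma Re_Dminus2 (mu nu : C) (f : R -> C) (x : R) : smoothC f ->
  Re (Dminus mu (Dminus nu f) x) =
  Derive (Derive (fun y => Re (f y))) x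
  - (Re nu * Derive (fun y => Re (f y)) x - Im nu * Derive (fun y => Im (f y)) x)
  - (Re mu * (Derive (fun y => Re (f y)) x - (Re nu * Re (f x) - Im nu * Im (f x)))
   - Im mu * (Derive (fun y => Im (f y)) x - (Re nu * Im (f x) + Im nu * Re (f x)))).
Proof.
  intros Hf. rewrite (equal_f (Re_Dminus mu (Dminus nu f)) x).
  rewrite (equal_f (Re_Dminus nu f) x), (equal_f (Im_Dminus nu f) x).
  rewrite Derive_Re_Dminus by exact Hf. ring.
Qed.

Lemma Im_Dminus2 (mu nu : C) (f : R -> C) (x : R) : smoothC f ->
  Im (Dminus mu (Dminus nu f) x) =
  Derive (Derive (fun y => Im (f y))) x
  - (Re nu * Derive (fun y => Im (f y)) x + Im nu * Derive (fun y => Re (f y)) x)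
  - (Re mu * (Derive (fun y => Im (f y)) x - (Re nu * Im (f x) + Im nu * Re (f x)))
   + Im mu * (Derive (fun y => Re (f y)) x - (Re nu * Re (f x) - Im nu * Im (f x)))).
Proof.
  intros Hf. rewrite (equal_f (Im_Dminus mu (Dminus nu f)) x).
  rewrite (equal_f (Re_Dminus nu f) x), (equal_f (Im_Dminus nu f) x).
  rewrite Derive_Im_Dminus by exact Hf. ring.
Qed.

Lemma Dminus_comm (mu nu : C) (f : R -> C) : smoothC f ->
  Dminus mu (Dminus nu f) = Dminus nu (Dminus mu f).
Proof.
  intros Hf. apply functional_extensionality; intros x. apply Ceq.
  - rewrite !Re_Dminus2 by exact Hf. ring.
  - rewrite !Im_Dminus2 by exact Hf. ring.
Qed.

(** The head of the list is the outermost factor; commuting it inwards lets a chosen factor act on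
    [f] first. *)
Lemma diff_op_Dminus (mus : list C) (mu : C) (f : R -> C) : smoothC f ->
  diff_op mus (Dminus mu f) = Dminus mu (diff_op mus f).
Proof.
  intros Hf. induction mus as [|nu mus IH]; [reflexivity|].
  change (Dminus nu (diff_op mus (Dminus mu f)) = Dminus mu (Dminus nu (diff_op mus f))).
  rewrite IH. apply Dminus_comm. now apply smoothC_diff_op.
Qed.

Lemma diff_op_linear (mus : list C) (u : R) (f g : R -> C) : smoothC f -> smoothC g ->
  diff_op mus (fun x => Cplus (f x) (Cmult (RtoC u) (g x))) =
  (fun x => Cplus (diff_op mus f x) (Cmult (RtoC u) (diff_op mus g x))).
Proof.
  intros Hf Hg. induction mus as [|mu mus IH]; [reflexivity|].
  change (Dminus mu (diff_op mus (fun x => Cplus (f x) (Cmult (RtoC u) (g x)))) =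
    (fun x => Cplus (Dminus mu (diff_op mus f) x)
                    (Cmult (RtoC u) (Dminus mu (diff_op mus g) x)))).
  rewrite IH.
  destruct (proj1 (smoothC_iff _) (smoothC_diff_op mus f Hf)) as [F1 F2].
  destruct (proj1 (smoothC_iff _) (smoothC_diff_op mus g Hg)) as [G1 G2].
  set (F := diff_op mus f) in *. set (G := diff_op mus g) in *.
  apply functional_extensionality; intros x. unfold Dminus, Dc, Dnc.
  change (fun y => Re (F y + RtoC u * G y)%C)
    with (fun y => Re (F y) + (u * Re (G y) - 0 * Im (G y))).
  change (fun y => Im (F y + RtoC u * G y)%C)
    with (fun y => Im (F y) + (u * Im (G y) + 0 * Re (G y))).
  replace (fun y => Re (F y) + (u * Re (G y) - 0 * Im (G y)))
    with (fun y => Re (F y) + u * Re (G y)) by (apply functional_extensionality; intro; ring).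
  replace (fun y => Im (F y) + (u * Im (G y) + 0 * Re (G y)))
    with (fun y => Im (F y) + u * Im (G y)) by (apply functional_extensionality; intro; ring).
  rewrite (Derive_n_smooth_plus (fun y => Re (F y)) (fun y => u * Re (G y)))
    by auto using smooth_scal.
  rewrite (Derive_n_smooth_plus (fun y => Im (F y)) (fun y => u * Im (G y)))
    by auto using smooth_scal.
  rewrite !Derive_n_scal_l. apply Ceq; simpl; ring.
Qed.

Lemma diff_op_zero (mus : list C) : diff_op mus (fun _ => RtoC 0) = (fun _ => RtoC 0).
Proof.
  induction mus as [|mu mus IH]; [reflexivity|].
  change (Dminus mu (diff_op mus (fun _ => RtoC 0)) = (fun _ => RtoC 0)).
  rewrite IH. apply functional_extensionality; intros x.
  unfold Dminus, Dc, Dnc. simpl. rewrite !Derive_const. apply Ceq; simpl; ring.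
Qed.

Lemma inE_RtoC_plus_scal (mus : list C) (u : R) (f g : R -> R) :
  inE mus (fun x => RtoC (f x)) -> inE mus (fun x => RtoC (g x)) ->
  inE mus (fun x => RtoC (f x + u * g x)).
Proof.
  intros [Hf Ef] [Hg Eg]. split.
  - rewrite smoothC_RtoC in *. auto using smooth_plus, smooth_scal.
  - intros x.
    replace (fun x => RtoC (f x + u * g x))
      with (fun x => Cplus (RtoC (f x)) (Cmult (RtoC u) (RtoC (g x))))
      by (apply functional_extensionality; intro; apply Ceq; simpl; ring).
    rewrite diff_op_linear, Ef, Eg by assumption. apply Ceq; simpl; ring.
Qed.

Lemma inE_RtoC_lincomb (mus : list C) (c : nat -> R) (q : nat -> R -> R) (N : nat) :
  (forall k, (k < N)%nat -> inE mus (fun x => RtoC (q k x))) ->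
  inE mus (fun x => RtoC (lincomb c q N x)).
Proof.
  induction N as [|N IH]; intros H.
  - split; [apply smoothC_RtoC; exact (smooth_const 0)|].
    intros x. exact (equal_f (diff_op_zero mus) x).
  - apply (inE_RtoC_plus_scal mus (c N) (lincomb c q N) (q N)); auto.
Qed.

(** Once the conjugate pair acts first, its product is the real operator [L], so a real function
    stays real. This is how [L] carries the full space into the one with the pair removed, where
    zeros are counted. *)
Lemma inE_conj_pair (lam : C) (mus : list C) (f : R -> R) : smooth f ->
  inE (lam :: Cconj lam :: mus) (fun x => RtoC (f x)) <->
  inE mus (fun x => RtoC (Lop (- (2 * Re lam)) (Re lam * Re lam + Im lam * Im lam) f x)).
Proof.
  intros Hf. assert (Hc := proj2 (smoothC_RtoC f) Hf).
  assert (E : diff_op (lam :: Cconj lam :: mus) (fun x => RtoC (f x)) =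
    diff_op mus (fun x =>
      RtoC (Lop (- (2 * Re lam)) (Re lam * Re lam + Im lam * Im lam) f x))).
  { change (Dminus lam (Dminus (Cconj lam) (diff_op mus (fun x => RtoC (f x)))) = 
      diff_op mus (fun x =>
      RtoC (Lop (- (2 * Re lam)) (Re lam * Re lam + Im lam * Im lam) f x))).
    rewrite <- diff_op_Dminus by exact Hc.
    rewrite <- diff_op_Dminus by now apply smoothC_Dminus.
    f_equal. apply functional_extensionality; intros x.
    assert (E0 : Derive (fun y => Im (RtoC (f y))) = (fun _ => 0)).
    { apply functional_extensionality; intros y. exact (Derive_const 0 y). }
    apply Ceq; [rewrite Re_Dminus2 by exact Hc | rewrite Im_Dminus2 by exact Hc];
      rewrite E0, ?Derive_const; change (fun y => Re (RtoC (f y))) with f;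
      unfold Cconj, Re, Im, RtoC; cbn [fst snd].
    - unfold Lop. change (Derive_n f 2 x) with (Derive (Derive f) x).
      change (Derive_n f 1 x) with (Derive f x). ring.
    - ring. }
  unfold inE. rewrite E, !smoothC_RtoC.
  split; intros [_ H]; (split; [|exact H]); auto using smooth_Lop.
Qed.

Lemma inE_osc (lam : C) (mus : list C) (w A B : R) : w * w = Im lam * Im lam ->
  inE (lam :: Cconj lam :: mus) (fun x => RtoC (osc (Re lam) w A B x)).
Proof.
  intros Hw. apply inE_conj_pair; [apply smooth_osc|]. rewrite <- Hw.
  split.
  - apply smoothC_RtoC, smooth_Lop, smooth_osc.
  - intros x. rewrite <- (equal_f (diff_op_zero mus) x). f_equal.
    apply functional_extensionality; intros y. now rewrite Lop_osc.
Qed.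

(** Otherwise [e^(r x) sin (w (x - a))] has the two zeros [a] and [a + PI/w] in [[a,b]], where a
    two-dimensional Chebyshev space allows one; it is non-zero halfway between them. *)
Lemma ECT_conj_pair_length (lam : C) (a b w : R) :
  a < b -> 0 < w -> w * w = Im lam * Im lam ->
  ECT (lam :: Cconj lam :: nil) a b -> w * (b - a) < PI.
Proof.
  intros Hab Hw Hwl HE. destruct (Rlt_or_le (w * (b - a)) PI) as [|Hge]; [assumption|exfalso].
  assert (HPI := PI_RGT_0).
  set (f := osc (Re lam) w (- sin (w * a)) (cos (w * a))).
  assert (Ef : forall x, f x = exp (Re lam * x) * sin (w * (x - a)))
    by (intros; apply osc_sin_minus_left).
  assert (Hpw : 0 < PI / w) by (now apply Rdiv_lt_0_compat).
  assert (Hle : PI / w <= b - a) by (apply Rle_div_l; lra).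
  assert (Hz : at_most_zeros (fun x => RtoC (f x)) 1 a b).
  { apply (HE (fun x => RtoC (f x)) (inE_osc lam nil w _ _ Hwl)).
    exists (a + PI / w / 2). split; [lra|]. rewrite Ef.
    replace (w * (a + PI / w / 2 - a)) with (PI / 2) by (field; lra).
    rewrite sin_PI2. intros E. apply RtoC_inj in E.
    assert (He := exp_pos (Re lam * (a + PI / w / 2))). lra. }
  assert (Hcount : (1 + (1 + 0) <= 1)%nat); [|lia].
  apply (at_most_zeros_RtoC f _ a b ((a, 1%nat) :: (a + PI / w, 1%nat) :: nil) Hz).
  - simpl. repeat constructor; simpl; intuition lra.
  - simpl. intros z [<-|[<-|[]]]; simpl; (split; [lra|]); intros j Hj;
      replace j with 0%nat by lia; simpl; rewrite Ef.
    + rewrite Rminus_diag, Rmult_0_r, sin_0. ring.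
    + replace (w * (a + PI / w - a)) with PI by (field; lra). rewrite sin_PI. ring.
Qed.

(** * From the complex to the real Bernstein basis *)

(** Exact order makes the leading derivatives non-zero, and non-negativity fixes their sign: with
    the wrong sign [-1 * f] would be positive near that endpoint. *)
Lemma bernstein_basis_real (mus : list C) (n : nat) (p : nat -> R -> C) (a b : R) :
  a < b -> bernstein_basis mus n p a b ->
  (forall k x, (k <= n)%nat -> Im (p k x) = 0) ->
  (forall k x, (k <= n)%nat -> a <= x <= b -> 0 <= Re (p k x)) ->
  real_bernstein n (fun k x => Re (p k x)) a b.
Proof.
  intros Hab Hp HIm HRe k Hk.
  destruct (Hp k Hk) as ([Hsm _] & [Ha Ha'] & [Hb Hb']).
  apply smoothC_iff in Hsm as [Hsm _].
  set (f := fun x => Re (p k x)) in *.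
  assert (HD : forall j x, Dnc (p k) j x = RtoC (Derive_n f j x)).
  { intros j x. unfold Dnc. fold f.
    replace (fun y => Im (p k y)) with (fun _ : R => 0)
      by (apply functional_extensionality; intro; now rewrite HIm).
    now rewrite Derive_n_zero. }
  assert (HDm : forall j x, Derive_n (fun y => -1 * f y) j x = - Derive_n f j x)
    by (intros; rewrite Derive_n_scal_l; ring).
  assert (H0a : forall j, (j < k)%nat -> Derive_n f j a = 0).
  { intros j Hj. apply RtoC_inj. rewrite <- HD. now apply Ha. }
  assert (H0b : forall j, (j < n - k)%nat -> Derive_n f j b = 0).
  { intros j Hj. apply RtoC_inj. rewrite <- HD. now apply Hb. }
  rewrite HD in Ha', Hb'.
  repeat split; auto.
  - destruct (Rtotal_order 0 (Derive_n f k a)) as [H|[H|H]]; [exact H | |].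
    + now rewrite <- H in Ha'.
    + exfalso.
      destruct (pos_right_of_zero k (fun y => -1 * f y) a) as [d [Hd Hpos]].
      * now apply smooth_scal.
      * intros j Hj. rewrite HDm, H0a by exact Hj. ring.
      * rewrite HDm. lra.
      * destruct (exists_right_near a b d Hab Hd) as (x & Hx).
        assert (H1 := Hpos x ltac:(lra)). assert (H2 := HRe k x Hk ltac:(lra)).
        fold (f x) in H2. lra.
  - destruct (Rtotal_order 0 ((-1) ^ (n - k) * Derive_n f (n - k) b)) as [H|[H|H]];
      [exact H | |].
    + symmetry in H. apply Rmult_integral in H as [H|H].
      * exfalso. revert H. apply pow_nonzero. lra.
      * now rewrite H in Hb'.
    + exfalso.
      destruct (pos_left_of_zero (n - k) (fun y => -1 * f y) b) as [d [Hd Hpos]].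
      * now apply smooth_scal.
      * intros j Hj. rewrite HDm, H0b by exact Hj. ring.
      * rewrite HDm. lra.
      * destruct (exists_left_near a b d Hab Hd) as (x & Hx).
        assert (H1 := Hpos x ltac:(lra)). assert (H2 := HRe k x Hk ltac:(lra)).
        fold (f x) in H2. lra.
Qed.

(** Matching derivatives up to order [n] at [a] gives the difference a zero of order [n+1], one more
    than the Chebyshev property allows. The matching stays in the conclusion because the positivity
    argument works with derivatives at [a]. *)
Lemma bernstein_expansion (mus : list C) (n : nat) (q : nat -> R -> R) (a b : R)
    (f : R -> R) :
  a < b -> length mus = S n -> ECT mus a b -> real_bernstein n q a b ->
  (forall k, (k <= n)%nat -> inE mus (fun x => RtoC (q k x))) ->
  inE mus (fun x => RtoC (f x)) ->
  exists c, (forall j, (j <= n)%nat ->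
      Derive_n f j a = Derive_n (lincomb c q (S n)) j a) /\
    (forall x, a <= x <= b -> f x = lincomb c q (S n) x).
Proof.
  intros Hab Hlen HE Hq Hin Hf.
  assert (Hsf : smooth f) by (apply smoothC_RtoC, Hf).
  destruct (bernstein_taylor n q a b f (S n) Hq Hsf (le_n _)) as [c Hc].
  exists c. split; [intros j Hj; apply Hc; lia|]. intros x Hx.
  destruct (Req_dec (f x) (lincomb c q (S n) x)) as [|Hne]; [assumption | exfalso].
  assert (Hl : smooth (lincomb c q (S n)))
    by (apply smooth_lincomb; intros i Hi; apply (Hq i); lia).
  set (g := fun x => f x + -1 * lincomb c q (S n) x).
  assert (Hz : at_most_zeros (fun x => RtoC (g x)) (length mus - 1) a b).
  { apply HE.
    - apply inE_RtoC_plus_scal; [exact Hf|]. apply inE_RtoC_lincomb.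
      intros k Hk. apply Hin. lia.
    - exists x. split; [exact Hx|]. intros E. apply RtoC_inj in E. unfold g in E. lra. }
  assert (Hcount : (S n + 0 <= length mus - 1)%nat); [|lia].
  apply (at_most_zeros_RtoC g _ a b ((a, S n) :: nil) Hz).
  - simpl. repeat constructor. intros [].
  - simpl. intros z [<-|[]]; simpl. split; [lra|]. intros j Hj. unfold g.
    rewrite Derive_n_smooth_plus, Derive_n_scal_l, Hc by auto using smooth_scal. ring.
Qed.

Lemma osc_opp (r w A B x : R) : osc r (- w) A B x = osc r w A (- B) x.
Proof.
  unfold osc. rewrite Ropp_mult_distr_l_reverse, cos_neg, sin_neg. ring.
Qed.

Lemma Bop_Re_Im (n : nat) (t alpha : nat -> R) (p : nat -> R -> C) (f : R -> C) (x : R) :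
  (forall k, (k <= n)%nat -> Im (p k x) = 0) ->
  Re (Bop n t alpha p f x) =
    lincomb (fun k => alpha k * Re (f (t k))) (fun k y => Re (p k y)) (S n) x /\
  Im (Bop n t alpha p f x) =
    lincomb (fun k => alpha k * Im (f (t k))) (fun k y => Re (p k y)) (S n) x.
Proof.
  intros HIm. unfold Bop, lincomb.
  assert (H : forall N, (N <= S n)%nat ->
    let z := csum (fun k => Cmult (Cmult (f (t k)) (RtoC (alpha k))) (p k x)) N in
    Re z = rsum (fun k => alpha k * Re (f (t k)) * Re (p k x)) N /\
    Im z = rsum (fun k => alpha k * Im (f (t k)) * Re (p k x)) N).
  { induction N as [|N IH]; intros HN; [split; reflexivity|].
    destruct (IH ltac:(lia)) as [E1 E2]. cbn zeta in *.
    cbn [csum rsum]. rewrite <- E1, <- E2.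
    assert (E := HIm N ltac:(lia)). unfold Im, Re in *.
    simpl. rewrite E. split; ring. }
  apply H. lia.
Qed.

Lemma lincomb_linear (u v : R) (c d : nat -> R) (q : nat -> R -> R) (N : nat) (x : R) :
  lincomb (fun k => u * c k + v * d k) q N x = u * lincomb c q N x + v * lincomb d q N x.
Proof.
  unfold lincomb. rewrite <- rsum_linear. apply rsum_ext. intros; ring.
Qed.

Lemma lincomb_ext (c d : nat -> R) (q : nat -> R -> R) (N : nat) (x : R) :
  (forall k, (k < N)%nat -> c k = d k) -> lincomb c q N x = lincomb d q N x.
Proof. intros H. apply rsum_ext. intros k Hk. now rewrite H. Qed.

(** As the [p k] are real, real and imaginary parts separate, and those of the exponentials span the
    real solutions. This reduces the complex problem to coefficients in one real basis. *)
Lemma Bop_fixes_cexp_iff (n : nat) (t alpha : nat -> R) (p : nat -> R -> C)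
    (lam : C) (w x : R) :
  w = Im lam \/ w = - Im lam ->
  (forall k, (k <= n)%nat -> Im (p k x) = 0) ->
  (Bop n t alpha p (cexp lam) x = cexp lam x /\
   Bop n t alpha p (cexp (Cconj lam)) x = cexp (Cconj lam) x) <->
  (forall A B, lincomb (fun k => alpha k * osc (Re lam) w A B (t k))
     (fun k y => Re (p k y)) (S n) x = osc (Re lam) w A B x).
Proof.
  intros Hw HIm. set (r := Re lam). set (v := Im lam) in *.
  set (q := fun k y => Re (p k y)).
  (* Changing the sign of the frequency only changes the sign of [B], which is universally
     quantified. *)
  assert (Hred : (forall A B, lincomb (fun k => alpha k * osc r w A B (t k)) q (S n) x
                    = osc r w A B x) <->
    (forall A B, lincomb (fun k => alpha k * osc r v A B (t k)) q (S n) x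
                    = osc r v A B x)).
  { destruct Hw as [->| ->]; [reflexivity|].
    split; intros H A B.
    - specialize (H A (- B)). rewrite osc_opp, Ropp_involutive in H. rewrite <- H.
      apply lincomb_ext. intros. now rewrite osc_opp, Ropp_involutive.
    - rewrite osc_opp, <- (H A (- B)). apply lincomb_ext. intros. now rewrite osc_opp. }
  rewrite Hred. clear Hred.
  assert (ER : forall y, Re (cexp lam y) = osc r v 1 0 y)
    by (intros; unfold osc; simpl; fold r v; ring).
  assert (EI : forall y, Im (cexp lam y) = osc r v 0 1 y)
    by (intros; unfold osc; simpl; fold r v; ring).
  assert (ER' : forall y, Re (cexp (Cconj lam) y) = osc r v 1 0 y).
  { intros. simpl. fold (Re lam) (Im lam). fold r v.
    rewrite Ropp_mult_distr_l_reverse, cos_neg. unfold osc. ring. }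
  assert (EI' : forall y, Im (cexp (Cconj lam) y) = osc r v 0 (-1) y).
  { intros. simpl. fold (Re lam) (Im lam). fold r v.
    rewrite Ropp_mult_distr_l_reverse, sin_neg. unfold osc. ring. }
  destruct (Bop_Re_Im n t alpha p (cexp lam) x HIm) as [B1 B2].
  destruct (Bop_Re_Im n t alpha p (cexp (Cconj lam)) x HIm) as [B3 B4].
  fold q in B1, B2, B3, B4.
  split.
  - intros [E _] A B. rewrite E in B1, B2. rewrite ER in B1. rewrite EI in B2.
    replace (osc r v A B x) with (A * osc r v 1 0 x + B * osc r v 0 1 x)
      by (unfold osc; ring).
    rewrite B1, B2, <- lincomb_linear. apply lincomb_ext. intros k _.
    rewrite ER, EI. unfold osc. ring.
  - intros H. split; apply Ceq.
    + rewrite B1, ER, <- H. apply lincomb_ext. intros; now rewrite ER.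
    + rewrite B2, EI, <- H. apply lincomb_ext. intros; now rewrite EI.
    + rewrite B3, ER', <- H. apply lincomb_ext. intros; now rewrite ER'.
    + rewrite B4, EI', <- H. apply lincomb_ext. intros; now rewrite EI'.
Qed.

Theorem theorem11 (n : nat) (lam : nat -> C) (a b : R) (p : nat -> R -> C) :
  (1 <= n)%nat ->
  Im (lam 0%nat) <> 0 ->
  lam 1%nat = Cconj (lam 0%nat) ->
  a < b ->
  ECT (lams lam 0 (S n)) a b -> conj_closed (lams lam 0 (S n)) ->
  ECT (lams lam 2 (n - 1)) a b -> conj_closed (lams lam 2 (n - 1)) ->
  ECT (lams lam 0 2) a b -> conj_closed (lams lam 0 2) ->
  bernstein_basis (lams lam 0 (S n)) n p a b ->
  (forall k x, (k <= n)%nat -> Im (p k x) = 0) ->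
  (forall k x, (k <= n)%nat -> a <= x <= b -> 0 <= Re (p k x)) ->
  exists t alpha : nat -> R,
    good_nodes lam n p a b t alpha /\
    (forall t' alpha' : nat -> R, good_nodes lam n p a b t' alpha' ->
       forall k, (k <= n)%nat -> t' k = t k /\ alpha' k = alpha k).
Proof.
  intros Hn HIm0 Hlam1 Hab HE _ HE2 _ HE01 _ Hbb HIm HRe.
  set (mus := lams lam 2 (n - 1)) in *.
  assert (Efull : lams lam 0 (S n) = lam 0%nat :: Cconj (lam 0%nat) :: mus).
  { rewrite <- Hlam1. unfold mus, lams. destruct n as [|n']; [lia|].
    simpl. now rewrite Nat.sub_0_r. }
  assert (Epair : lams lam 0 2 = lam 0%nat :: Cconj (lam 0%nat) :: nil).
  { rewrite <- Hlam1. reflexivity. }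
  assert (Hlen : length mus = (n - 1)%nat).
  { unfold mus, lams. now rewrite length_map, length_seq. }
  rewrite Efull in HE, Hbb. rewrite Epair in HE01.
  set (l := lam 0%nat) in *. set (r := Re l). set (w := Rabs (Im l)).
  assert (Hw : 0 < w) by (now apply Rabs_pos_lt).
  assert (Hww : w * w = Im l * Im l) by (symmetry; apply Rsqr_abs).
  assert (Hws : w = Im l \/ w = - Im l).
  { unfold w, Rabs. destruct Rcase_abs; auto. }
  assert (HPI := ECT_conj_pair_length l a b w Hab Hw Hww HE01).
  set (q := fun k x => Re (p k x)).
  assert (Hq : real_bernstein n q a b) by exact (bernstein_basis_real _ n p a b Hab Hbb HIm HRe).
  assert (Hin : forall k, (k <= n)%nat ->
    inE (l :: Cconj l :: mus) (fun x => RtoC (q k x))).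
  { intros k Hk. destruct (Hbb k Hk) as [H _].
    replace (fun x => RtoC (q k x)) with (p k); [exact H|].
    apply functional_extensionality; intros x. apply Ceq; [reflexivity|]. now apply HIm. }
  assert (Hexp : forall A B, exists c,
    (forall j, (j <= n)%nat ->
       Derive_n (osc r w A B) j a = Derive_n (lincomb c q (S n)) j a) /\
    (forall x, a <= x <= b -> osc r w A B x = lincomb c q (S n) x)).
  { intros A B. apply (bernstein_expansion (l :: Cconj l :: mus)); auto.
    - simpl. lia.
    - now apply inE_osc. }
  set (phi := osc r w (- sin (w * a)) (cos (w * a))).
  set (psi := osc r w (sin (w * b)) (- cos (w * b))).
  destruct (Hexp (- sin (w * a)) (cos (w * a))) as (c & Hc & Hc').
  destruct (Hexp (sin (w * b)) (- cos (w * b))) as (d & Hd & Hd').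
  fold phi in Hc, Hc'. fold psi in Hd, Hd'.
  assert (Hpos : forall k, (k <= n)%nat -> 0 <= c k /\ 0 <= d k /\ 0 < c k + d k).
  { apply (osc_coefs_positive n q a b r w c d Hn Hab Hw HPI Hq); auto.
    (* [L] of a partial sum lies in the space of [mus], whose Chebyshev property bounds its zeros by
       [n - 2]. *)
    - intros e m g Hm [x [Hx Hgx]]. replace (n - 2)%nat with (length mus - 1)%nat by lia.
      apply HE2.
      + unfold g. rewrite Hww. apply inE_conj_pair.
        * apply smooth_lincomb. intros i Hi. apply (Hq i). lia.
        * apply inE_RtoC_lincomb. intros k Hk. apply Hin. lia.
      + exists x. split; [exact Hx|]. intros E. now apply RtoC_inj in E.
    - apply Hc'. lra.
    - apply Hd'. lra. }
  (* The bound on [k] sits inside the existential so that choice applies to every index; [(0, 0)] is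
     a dummy beyond [n]. *)
  assert (Hnode : forall k, exists ta : R * R, (k <= n)%nat ->
    a <= fst ta <= b /\ 0 < snd ta /\
    snd ta * phi (fst ta) = c k /\ snd ta * psi (fst ta) = d k).
  { intros k. destruct (le_dec k n) as [Hk|Hk]; [|exists (0, 0); intros; lia].
    destruct (Hpos k Hk) as (H1 & H2 & H3).
    destruct (node_exists a b r w (c k) (d k)) as (t & al & H); auto.
    exists (t, al). intros _. unfold phi, psi. simpl.
    now rewrite osc_sin_minus_left, osc_sin_minus_right. }
  set (ta := fun k => proj1_sig (constructive_indefinite_description _ (Hnode k))).
  assert (Hta : forall k, (k <= n)%nat ->
    a <= fst (ta k) <= b /\ 0 < snd (ta k) /\
    snd (ta k) * phi (fst (ta k)) = c k /\ snd (ta k) * psi (fst (ta k)) = d k).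
  { intros k. exact (proj2_sig (constructive_indefinite_description _ (Hnode k))). }
  exists (fun k => fst (ta k)), (fun k => snd (ta k)).
  assert (Hsin : 0 < sin (w * (b - a))) by (apply sin_gt_0; nra).
  split; [split|].
  - intros k Hk. destruct (Hta k Hk) as (H1 & H2 & _). auto.
  - intros x Hx. rewrite Hlam1. fold l.
    apply (Bop_fixes_cexp_iff n _ _ p l w x Hws); [intros; now apply HIm|].
    fold r q. intros A B.
    apply (Rmult_eq_reg_l (sin (w * (b - a)))); [|lra].
    rewrite osc_endpoint_decomposition, <- osc_sin_minus_left, <- osc_sin_minus_right.
    fold phi psi. rewrite (Hc' x Hx), (Hd' x Hx), <- lincomb_linear.
    (* A zero multiple is added on the left so that [lincomb_linear] also merges that side; the
       identity is then checked coefficient by coefficient. *)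
    rewrite <- (Rplus_0_r (sin _ * _)), <- (Rmult_0_l (lincomb c q (S n) x)).
    rewrite <- lincomb_linear. apply lincomb_ext. intros k Hk.
    destruct (Hta k ltac:(lia)) as (_ & _ & Ec & Ed).
    rewrite <- Ec, <- Ed, Rmult_0_l, Rplus_0_r.
    replace (sin (w * (b - a)) * (snd (ta k) * osc r w A B (fst (ta k))))
      with (snd (ta k) * (sin (w * (b - a)) * osc r w A B (fst (ta k)))) by ring.
    rewrite osc_endpoint_decomposition, <- osc_sin_minus_left, <- osc_sin_minus_right.
    fold phi psi. ring.
  - intros t' al' [Hrange Hfix] k Hk.
    (* Any admissible nodes and weights reproduce each real solution, so [al' k] times its value at
       [t' k] is its Bernstein coefficient, which is unique by independence. *)
    assert (Hcoef : forall A B e, (forall x, a <= x <= b -> osc r w A B x = lincomb e q (S n) x) ->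
      al' k * osc r w A B (t' k) = e k).
    { intros A B e He.
      assert (E : 1 * (al' k * osc r w A B (t' k)) + -1 * e k = 0); [|lra].
      apply (bernstein_independent n q a b
        (fun k => 1 * (al' k * osc r w A B (t' k)) + -1 * e k) Hab Hq); [|exact Hk].
      intros x Hx. rewrite (lincomb_linear 1 (-1) (fun k => al' k * osc r w A B (t' k)) e).
      rewrite <- (He x Hx). destruct (Hfix x Hx) as [E0 E1]. rewrite Hlam1 in E1.
      assert (E := proj1 (Bop_fixes_cexp_iff n t' al' p l w x Hws (fun k Hk => HIm k x Hk))
        (conj E0 E1) A B). fold r q in E. rewrite E. ring. }
    assert (E1 := Hcoef _ _ c Hc'). assert (E2 := Hcoef _ _ d Hd').
    destruct (Hta k Hk) as (Ht & Hal & Ec & Ed). destruct (Hrange k Hk) as [Ht' Hal'].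
    rewrite <- Ec in E1. rewrite <- Ed in E2. unfold phi in E1. unfold psi in E2.
    rewrite !osc_sin_minus_left in E1. rewrite !osc_sin_minus_right in E2.
    apply (node_unique a b r w); assumption.
Qed.
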